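(* Let $N\ge 3$, $n\ge 2$, let $a_1,\dots,a_n\in\mathbb{R}^N$ be distinct poles, and let $r_0=\min_{i\ne j}|a_i-a_j|/2$. Let $\mu\ge 0$ be a weight function on $\mathbb{R}^N$ satisfying the following hypotheses. $H_1)$ $\nabla\mu\in L^1_{loc}(\mathbb{R}^N)$, $\sqrt{\mu}\in H^1_{loc}(\mathbb{R}^N)$ and $\mu^{-1}\in L^1_{loc}(\mathbb{R}^N)$. $H_2')$ There exist constants $k_1,k_2\in\mathbb{R}$, $k_2>2-N$, such that if $$f_{\varepsilon,i}=(\varepsilon+|x-a_i|^2)^{\frac{\alpha}{2}},\qquad \alpha<0,\quad \varepsilon>0,$$ it holds $$\frac{\nabla f_{\varepsilon,i}}{f_{\varepsilon,i}}\cdot\nabla\mu=\frac{\alpha(x-a_i)}{\varepsilon+|x-a_i|^2}\cdot\nabla\mu\ \le\ \Bigl(k_1+\frac{k_2\alpha}{\varepsilon+|x-a_i|^2}\Bigr)\mu\qquad\text{in }B(a_i,r_0)$$ for any $i=1,\dots,n$ and for any $\varepsilon>0$. $H_3)$ There exists $i\in\{1,\dots,n\}$ such that $$\sup\Bigl\{\delta\in\mathbb{R}:\ \frac{1}{|x-a_i|^{\delta}}\in L^1_{loc}(\mathbb{R}^N,d\mu)\Bigr\}=N+k_2.$$ Then for $c>c_o(N+k_2)=\left(\frac{N+k_2-2}{2}\right)^2$ the inequality $$c\int_{\mathbb{R}^N}\sum_{i=1}^n\frac{\varphi^2}{|x-a_i|^2}\,d\mu\ \le\ \int_{\mathbb{R}^N}|\nabla\varphi|^2\,d\mu+\left[\frac{k_0+(n+1)c}{r_0^2}+k_1\right]\int_{\mathbb{R}^N}\varphi^2\,d\mu,$$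 with a constant $k_0\in[0,\pi^2)$, does not hold for all $\varphi\in H^1_\mu$.
   Context: Here $d\mu(x)=\mu(x)\,dx$, $L^2_\mu:=L^2(\mathbb{R}^N,d\mu)$, and $B(a,r)$ is the open ball of center $a$ and radius $r$. The weighted Sobolev space $H^1_\mu$ is the completion of $C_c^\infty(\mathbb{R}^N)$ with respect to the norm $\|u\|_{H^1_\mu}^2:=\|u\|_{L^2_\mu}^2+\|\nabla u\|_{L^2_\mu}^2$. *)

(* Defs.v *)
From HB Require Import structures.
From mathcomp Require Import all_boot all_order all_algebra.
From mathcomp Require Import all_classical all_reals all_analysis.
From mathcomp Require Import measurable_realfun.

Set Implicit Arguments.
Unset Strict Implicit.
Unset Printing Implicit Defensive.
Import Order.TTheory GRing.Theory Num.Theory.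
Import numFieldNormedType.Exports.

Local Open Scope classical_set_scope.
Local Open Scope ring_scope.

Section borel_rV.
Context (R : realType) (N : nat).

HB.instance Definition _ := @isMeasurable.Build
  (sigma_display (@open 'rV[R]_N)) 'rV[R]_N <<s (@open 'rV[R]_N) >>
  (@sigma_algebra0 _ setT (@open 'rV[R]_N))
  (@sigma_algebraC _ (@open 'rV[R]_N))
  (@sigma_algebra_bigcup _ setT (@open 'rV[R]_N)).

Lemma open_measurable_rV (U : set 'rV[R]_N) : open U -> measurable U.
Proof. exact: sub_sigma_algebra. Qed.

Lemma measurable_coord (i : 'I_N) :
  measurable_fun [set: 'rV[R]_N] (fun v : 'rV[R]_N => v ord0 i).
Proof.
apply: (measurability _ (RGenOpens.measurableE R)).
move=> _ [_ [a [b ->]] <-].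
rewrite setTI; apply: open_measurable_rV; apply: open_comp.
  by move=> v _; exact: coord_continuous.
exact: interval_open.
Qed.

Lemma open_rV_bigcup (U : set 'rV[R]_N) : open U ->
  U = \bigcup_(p in [set p : 'rV[rat]_N * nat |
        ball (map_mx (@ratr R) p.1) p.2.+1%:R^-1 `<=` U])
      ball (map_mx (@ratr R) p.1) p.2.+1%:R^-1.
Proof.
move=> oU; apply/seteqP; split=> [x Ux|x [p /= pU px]]; last exact: pU.
have /nbhs_ballP[e /= e0 xeU] : nbhs x U by exact: open_nbhs_nbhs.
have [k ke] : exists k : nat, k.+1%:R^-1 < e / 2.
  exists (Num.trunc (e / 2)^-1).
  rewrite invf_plt ?posrE ?divr_gt0//.
  exact: truncnS_gt.
have k0 : (0 : R) < k.+1%:R^-1 by rewrite invr_gt0.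
have /choice[q qP] : forall i, exists q : rat,
    ball (ratr q : R) k.+1%:R^-1 (x ord0 i).
  move=> i.
  have /rat_in_itvoo[q] : x ord0 i - k.+1%:R^-1 < x ord0 i + k.+1%:R^-1.
    by rewrite ltrD2l gtrN.
  rewrite in_itv/= => qx; exists q.
  by rewrite /ball/= ltr_distl; move/andP: qx => [qx1 qx2]; apply/andP; split.
have Bx : ball (map_mx (@ratr R) (\row_i q i)) k.+1%:R^-1 x.
  by split=> // i j; rewrite !mxE ord1.
exists (\row_i q i, k) => //= y qy; apply: xeU.
rewrite (splitr e); apply: (@ball_triangle _ _ (map_mx (@ratr R) (\row_i q i))).
  by apply: ball_sym; apply: le_ball Bx; exact: ltW.
by apply: le_ball qy; exact: ltW.
Qed.

Lemma measurable_fun_rV d (T : measurableType d) (f : T -> 'rV[R]_N) :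
  (forall i, measurable_fun [set: T] (fun t => f t ord0 i)) ->
  measurable_fun [set: T] f.
Proof.
move=> mf; apply: (@measurability _ _ _ _ _ _ (@open 'rV[R]_N)) => //.
move=> _ [U oU <-]; rewrite setTI (open_rV_bigcup oU) preimage_bigcup.
rewrite bigcup_mkcond; apply: countable_bigcupT_measurable => // p.
case: ifPn => // _.
have -> : f @^-1` ball (map_mx (@ratr R) p.1) p.2.+1%:R^-1 =
    \bigcap_(i in [set: 'I_N])
      ((fun t => f t ord0 i) @^-1` ball (ratr (p.1 ord0 i) : R) p.2.+1%:R^-1).
  apply/seteqP; split=> [t [_ Bt] i _|t Bt]/=.
    by have := Bt ord0 i; rewrite mxE.
  split; first by rewrite invr_gt0.
  by move=> i j; rewrite mxE ord1; exact: Bt.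
apply: fin_bigcap_measurable => [|i _]; first exact: finite_finset.
rewrite -[X in measurable X]setTI; apply: mf => //.
exact: measurable_ball.
Qed.

End borel_rV.

Section cons_rV.
Context (R : realType) (n : nat).

Definition cons_rV (p : R * 'rV[R]_n) : 'rV[R]_n.+1 :=
  \row_i oapp (fun j => p.2 ord0 j) p.1 (unlift ord0 i).

Definition uncons_rV (v : 'rV[R]_n.+1) : R * 'rV[R]_n :=
  (v ord0 ord0, \row_j v ord0 (lift ord0 j)).

Lemma cons_rVK : cancel cons_rV uncons_rV.
Proof.
move=> [x v]; rewrite /uncons_rV !mxE unlift_none; congr pair.
by apply/rowP => j; rewrite !mxE liftK.
Qed.

Lemma measurable_cons_rV : measurable_fun [set: R * 'rV[R]_n] cons_rV.
Proof.
apply: measurable_fun_rV => i.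
under eq_fun do rewrite mxE.
case: unliftP => [j _|_] /=; last exact: measurable_fst.
exact: (measurableT_comp (measurable_coord j) measurable_snd).
Qed.

Lemma measurable_uncons_rV : measurable_fun [set: 'rV[R]_n.+1] uncons_rV.
Proof.
apply: measurable_fun_pair; first exact: measurable_coord.
apply: measurable_fun_rV => i.
by under eq_fun do rewrite mxE; exact: measurable_coord.
Qed.

Variable m : {sigma_finite_measure set 'rV[R]_n -> \bar R}.

Definition cons_measure : set 'rV[R]_n.+1 -> \bar R :=
  pushforward (lebesgue_measure \x m)%E cons_rV.

Let cons_measure0 : cons_measure set0 = 0%E.
Proof. by rewrite /cons_measure /pushforward preimage_set0 measure0. Qed.

Let cons_measure_ge0 A : (0 <= cons_measure A)%E.
Proof. by rewrite /cons_measure /pushforward measure_ge0. Qed.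

Let cons_measure_sigma_additive : semi_sigma_additive cons_measure.
Proof.
exact: (@measure_semi_sigma_additive _ _ _
  (measure_function_pushforward__canonical__measure_function_Measure
    (lebesgue_measure \x m)%E measurable_cons_rV)).
Qed.

HB.instance Definition _ := isMeasure.Build _ _ _ cons_measure
  cons_measure0 cons_measure_ge0 cons_measure_sigma_additive.

Let cons_measure_sigma_finite : sigma_finite setT cons_measure.
Proof.
have /sigma_finiteP[F [TF ndF Foo]] := sigma_finiteT (@lebesgue_measure R).
have /sigma_finiteP[G [TG ndG Goo]] := sigma_finiteT m.
exists (fun k => uncons_rV @^-1` (F k `*` G k)).
  rewrite -preimage_bigcup -[LHS](preimage_setT uncons_rV); congr (_ @^-1` _).
  rewrite -setXTT TF TG predeqE => -[x y]; split.
    move=> [/= [i _ Fix] [k _ Gky]]; exists (maxn i k) => //; split.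
    - by move: x Fix; exact/subsetPset/ndF/leq_maxl.
    - by move: y Gky; exact/subsetPset/ndG/leq_maxr.
  by move=> [i _ []/= ? ?]; split; exists i.
move=> k; have [mF Fk] := Foo k; have [mG Gk] := Goo k; split.
  rewrite -[X in measurable X]setTI; apply: measurable_uncons_rV => //.
  exact: measurableX.
rewrite /cons_measure /pushforward -comp_preimage.
rewrite (_ : uncons_rV \o cons_rV = id); last exact/funext/cons_rVK.
by rewrite preimage_id product_measure1E// lte_mul_pinfty// ge0_fin_numE.
Qed.

HB.instance Definition _ := Measure_isSigmaFinite.Build _ _ _ cons_measure
  cons_measure_sigma_finite.

End cons_rV.

Fixpoint lebesgue_rV (R : realType) (N : nat) :
    {sigma_finite_measure set 'rV[R]_N -> \bar R} :=
  match N with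
  | 0 => \d_(0 : 'rV[R]_0)
  | n.+1 => cons_measure (lebesgue_rV R n)
  end.

Lemma measurable_box (R : realType) (N : nat) (A : 'I_N -> set R) :
  (forall i, measurable (A i)) ->
  measurable [set v : 'rV[R]_N | forall i, A i (v ord0 i)].
Proof.
move=> mA.
rewrite (_ : [set v | _] = \bigcap_(i in [set: 'I_N])
    ((fun v : 'rV[R]_N => v ord0 i) @^-1` A i)); last first.
  by apply/seteqP; split=> v Av i; [move=> _|]; exact: Av.
apply: fin_bigcap_measurable => [|i _]; first exact: finite_finset.
by rewrite -[X in measurable X]setTI; exact: measurable_coord.
Qed.

Lemma lebesgue_rV_box (R : realType) (N : nat) (A : 'I_N -> set R) :
  (forall i, measurable (A i)) ->
  lebesgue_rV R N [set v | forall i, A i (v ord0 i)] =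
  (\prod_(i < N) lebesgue_measure (A i))%E.
Proof.
elim: N A => [|N IHN] A mA /=.
  rewrite big_ord0 diracE mem_set//= => i.
  by case: i.
rewrite big_ord_recl -IHN//.
have mB := measurable_box (fun i => mA (lift ord0 i)).
rewrite -(product_measure1E lebesgue_measure (lebesgue_rV R N) (mA ord0) mB).
rewrite /cons_measure /pushforward; congr (_ _).
apply/seteqP; split=> -[x v] /=.
  move=> Axv; split => [|i]; first by have := Axv ord0; rewrite mxE unlift_none.
  by have := Axv (lift ord0 i); rewrite mxE liftK.
move=> [/= Ax Av] i; rewrite mxE.
by case: unliftP => [j ->|->] //=; exact: Av.
Qed.

Section euclidean.
Context (R : realType) (N : nat).
Implicit Types (f : 'rV[R]_N -> R) (u v x a : 'rV[R]_N).

Definition dot u v : R := \sum_(i < N) u ord0 i * v ord0 i.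

(* The library norm `|x| on row vectors is the sup norm, whence [enorm]. *)
Definition enorm u : R := Num.sqrt (dot u u).

Definition eball a (r : R) : set 'rV[R]_N := [set x | enorm (x - a) < r].

Definition partial (i : 'I_N) f : 'rV[R]_N -> R :=
  fun x => 'D_(delta_mx ord0 i) f x.

Definition grad f : 'rV[R]_N -> 'rV[R]_N := fun x => \row_i partial i f x.

(* C^infinity: the iterated partial derivative along any list of coordinate
   directions is continuous and partially differentiable everywhere. *)
Definition smooth f := forall s : seq 'I_N,
  continuous (foldr partial f s) /\
  forall i x, derivable (foldr partial f s) x (delta_mx ord0 i).

Definition test_function f :=
  smooth f /\ compact (closure [set x | f x != 0]).

End euclidean.

Section local_spaces.
Context (R : realType) (N : nat).
Local Notation leb := (lebesgue_rV R N).

Definition loc_integrable (f : 'rV[R]_N -> \bar R) :=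
  measurable_fun [set: 'rV[R]_N] f /\
  forall K : set 'rV[R]_N, compact K ->
    (\int[leb]_(x in K) `|f x| < +oo)%E.

(* [G] is a representative of the distributional gradient of [f], and both are
   locally integrable. *)
Definition weak_gradient (f : 'rV[R]_N -> R) (G : 'rV[R]_N -> 'rV[R]_N) :=
  [/\ loc_integrable (EFin \o f),
      forall i, loc_integrable (fun x => (G x ord0 i)%:E) &
      forall (psi : 'rV[R]_N -> R) (i : 'I_N), test_function psi ->
        (\int[leb]_x (f x * partial i psi x)%:E =
         - \int[leb]_x (G x ord0 i * psi x)%:E)%E].

Definition H1loc (f : 'rV[R]_N -> R) := exists G : 'rV[R]_N -> 'rV[R]_N,
  [/\ weak_gradient f G,
      loc_integrable (fun x => (f x ^+ 2)%:E) &
      forall i, loc_integrable (fun x => (G x ord0 i ^+ 2)%:E)].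

End local_spaces.

Section weighted_spaces.
Context (R : realType) (N : nat) (mu : 'rV[R]_N -> R).
Local Notation leb := (lebesgue_rV R N).

Definition int_mu (f : 'rV[R]_N -> R) : \bar R :=
  (\int[leb]_x (f x * mu x)%:E)%E.

Definition loc_integrable_mu (f : 'rV[R]_N -> R) :=
  loc_integrable (fun x => (f x * mu x)%:E).

Definition L2_mu (f : 'rV[R]_N -> R) :=
  measurable_fun [set: 'rV[R]_N] f /\ (int_mu (fun x => (f x ^+ 2)%R) < +oo)%E.

(* The completion of C_c^infinity for the H^1_mu norm, realized as the closure
   of {(u, grad u)} in L^2_mu x (L^2_mu)^N: [H1_mu phi Dphi] says that [phi] is
   (a representative of) an element of the completion and [Dphi] of its
   gradient. *)
Definition H1_mu (phi : 'rV[R]_N -> R) (Dphi : 'rV[R]_N -> 'rV[R]_N) :=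
  [/\ L2_mu phi,
      forall i, L2_mu (fun x => Dphi x ord0 i) &
      exists u : nat -> 'rV[R]_N -> R,
        (forall k, test_function (u k)) /\
        ((int_mu (fun x => ((u k x - phi x) ^+ 2)%R) +
          int_mu (fun x => (enorm (grad (u k) x - Dphi x) ^+ 2)%R))%E
            @[k --> \oo] --> 0%E)].

End weighted_spaces.

Section hypotheses.
Context (R : realType) (N n : nat).
Implicit Types (a : 'I_n -> 'rV[R]_N) (mu : 'rV[R]_N -> R)
  (Dmu : 'rV[R]_N -> 'rV[R]_N).

(* An infimum over finitely many pairs, hence a minimum when 1 < n. *)
Definition pole_radius a : R :=
  inf [set d | exists i j, i != j /\ d = enorm (a i - a j) / 2].

(* The inverse of mu is taken in \bar R, where 0^-1 = +oo (in R, 0^-1 = 0 would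
   hide the zeros of mu). *)
Definition hypothesis_H1 mu Dmu :=
  [/\ weak_gradient mu Dmu,
      H1loc (fun x => Num.sqrt (mu x)) &
      loc_integrable (fun x => ((mu x)%:E^-1)%E)].

Definition f_eps (alpha eps : R) (p : 'rV[R]_N) : 'rV[R]_N -> R :=
  fun x => (eps + enorm (x - p) ^+ 2) `^ (alpha / 2).

Definition hypothesis_H2' a mu Dmu (k1 k2 alpha : R) :=
  forall (i : 'I_n) (eps : R), 0 < eps ->
    let f := f_eps alpha eps (a i) in
    {ae lebesgue_rV R N, forall x, eball (a i) (pole_radius a) x ->
      dot ((f x)^-1 *: grad f x) (Dmu x) <=
      (k1 + k2 * alpha / (eps + enorm (x - a i) ^+ 2)) * mu x}.

Definition hypothesis_H3 a mu (k2 : R) := exists i : 'I_n,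
  ereal_sup [set delta%:E | delta in
    [set delta : R |
      loc_integrable_mu mu (fun x => (enorm (x - a i) `^ delta)^-1)]] =
  (N%:R + k2)%:E.

End hypotheses.

(* Main.v *)
(** Let [a] be the pole of [H3], [q = |x - a|^2], [d = N + k2 > 2], and test the
    inequality on [phi_e = (e + q)^(-s/2) F(1 - q)], where [F u = exp (-1/u)] for
    [u > 0] and [F u = 0] otherwise, with [(d-2)/2 < s < d/2] and [s^2 < c].
    For every [lam > 0],
      [|grad phi_e|^2 <= (1 + lam) s^2 phi_e^2 / q + C q^(-s) 1_(q <= 1)],
    and [q^(-s)] is locally [mu]-integrable because [2 s < d].  Choosing [lam]
    with [(1 + lam) s^2 < c], the inequality bounds [\int phi_e^2 / q dmu]
    uniformly in [e]; this integral is finite because [2 < d].  As [e -> 0], it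
    follows that [q^(-(s+1)) = |x - a|^(-2(s+1))] is locally [mu]-integrable,
    which contradicts [H3] since [2 (s + 1) > d]. *)
Require Import Defs.
From HB Require Import structures.
From mathcomp Require Import all_boot all_order all_algebra.
From mathcomp Require Import all_classical all_reals all_analysis.
From mathcomp Require Import measurable_realfun.
From mathcomp Require Import ring lra.

Set Implicit Arguments.
Unset Strict Implicit.
Unset Printing Implicit Defensive.
Import Order.TTheory GRing.Theory Num.Theory.
Import numFieldNormedType.Exports.

Local Open Scope classical_set_scope.
Local Open Scope ring_scope.

(** * Flat functions [P(1/u) exp(-1/u)] and their derivatives *)

Section flat.
Context (R : realType).
Implicit Types (P : {poly R}) (u y : R).

(** Letting [P] range over all polynomials makes the family closed under differentiation; [P = 1] is
    the standard flat function. *)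
Definition flat P u : R := if 0 < u then P.[u^-1] * expR (- u^-1) else 0.

(** The term [y^n / n!] of the exponential series is at most [exp y]. *)
Lemma exprn_le_expR n y : 0 <= y -> y ^+ n * expR (- y) <= n`!%:R.
Proof.
move=> y0; rewrite expRN ler_pdivrMr ?expR_gt0//.
case: n => [|n]; first by rewrite expr0 mul1r -expR0 ler_expR.
have f0 : (0 : R) < n.+1`!%:R by rewrite ltr0n fact_gt0.
rewrite mulrC -ler_pdivrMr//; apply: le_trans (expR_ge1Dxn n y0).
by rewrite lerDr.
Qed.

Lemma horner_le_exprn P : exists2 C : R, 0 <= C &
  forall y, 1 <= y -> `|P.[y]| <= C * y ^+ size P.
Proof.
exists (\sum_(i < size P) `|P`_i|); first exact: sumr_ge0.
move=> y y1; have y0 : 0 <= y by exact: le_trans y1.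
rewrite horner_coef; apply: le_trans (ler_norm_sum _ _ _) _.
rewrite mulr_suml; apply: ler_sum => i _.
rewrite normrM normrX (ger0_norm y0) ler_wpM2l//.
by rewrite ler_weXn2l// ltnW.
Qed.

(** With [y = 1/u >= 1], the polynomial is at most a multiple of [y^(size P)], and two further
    powers of [y] are still beaten by [exp (-y)]. Order 2 is what differentiability at 0
    requires. *)
Lemma flat_le_sqr P : exists2 C : R, 0 <= C &
  forall u, u <= 1 -> `|flat P u| <= C * u ^+ 2.
Proof.
have [C C0 PC] := horner_le_exprn P.
exists (C * (size P + 2)`!%:R); first by rewrite mulr_ge0.
move=> u u1; rewrite /flat; case: ifPn => u0; last first.
  by rewrite normr0 mulr_ge0 ?sqr_ge0// mulr_ge0.
have uV1 : 1 <= u^-1 by rewrite invf_ge1.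
rewrite normrM (ger0_norm (expR_ge0 _)).
apply: le_trans (ler_wpM2r (expR_ge0 _) (PC _ uV1)) _.
rewrite -!mulrA ler_wpM2l// -ler_pdivrMr ?exprn_gt0//.
have uV0 : 0 <= u^-1 by exact: le_trans uV1.
apply: le_trans (exprn_le_expR (size P + 2) uV0).
by rewrite exprD -exprVn [leRHS]mulrAC.
Qed.

(** For [u > 0], both [P(1/u)] and [exp(-1/u)] produce a factor [u^(-2)] on differentiation, which
    becomes the ['X^2] of the new polynomial. *)
Lemma is_derive_flat P u :
  is_derive u 1 (flat P) (flat ('X^2 * (P - P^`())) u).
Proof.
have [u0|u0|->] := ltgtP u 0.
- rewrite {2}/flat ltNge (ltW u0)/=.
  apply: (@near_eq_is_derive _ _ _ (cst 0)).
  near=> t; rewrite /flat ltNge ltW//; near: t; exact: lt_nbhsl.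
- rewrite {2}/flat u0.
  apply: (@near_eq_is_derive _ _ _ (fun t : R => P.[t^-1] * expR (- t^-1) : R)).
    by near=> t; rewrite /flat ifT//; near: t; exact: lt_nbhsr.
  have uN0 : u != 0 by rewrite gt_eqF.
  have dV : is_derive u 1 (fun t : R => t^-1) (- u ^- 2).
    by apply: is_derive_eq; [exact: (@is_deriveV _ id)|rewrite [LHS]mulr1].
  have dP : is_derive u 1 (fun t : R => P.[t^-1]) (P^`().[u^-1] * - u ^- 2).
    apply: (@is_derive1_comp _ (horner P) (fun t => t^-1)).
  have dE : is_derive u 1 (fun t : R => expR (- t^-1))
      (expR (- u^-1) * - (- u ^- 2)).
    apply: (@is_derive1_comp _ expR (fun t => - t^-1)).
  apply: is_derive_eq.
  rewrite !hornerE/= /GRing.scale/= -exprVn; ring.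
(* At 0 the quadratic bound makes the difference quotient at most [C * |h|], so it tends to 0. *)
- have flat0 Q : flat Q 0 = 0 by rewrite /flat ltxx.
  rewrite flat0; have [C C0 PC] := flat_le_sqr P.
  have dq0 : h^-1 *: ((flat P \o shift 0) (h *: 1) - flat P 0) @[h --> 0^'] --> 0.
    apply/cvgr0Pnorm_le => e e0; near=> h.
    have h0 : h != 0 by near: h; exact: nbhs_dnbhs_neq.
    rewrite flat0 subr0 /= addr0 [_%:A]mulr1 normrZ normfV.
    rewrite ler_pdivrMl ?normr_gt0//.
    have h1 : `|h| <= 1.
      near: h; apply: dnbhs0_le; exact: ltr01.
    apply: le_trans (PC _ (le_trans (ler_norm _) h1)) _.
    rewrite -(real_normK (num_real h)) expr2 mulrCA ler_wpM2l//.
    have : `|h| <= e / (C + 1).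
      by near: h; apply: dnbhs0_le; rewrite divr_gt0// ltr_wpDl.
    rewrite ler_pdivlMr ?ltr_wpDl// => /(le_trans _); apply.
    by rewrite mulrC ler_wpM2l// lerDl.
  by split; [apply/cvg_ex; exists 0|exact: cvg_lim dq0].
Unshelve. all: by end_near. Qed.

End flat.

(** * Chain rule for a real function composed with a function on a normed space *)

Lemma differentiable_powR (R : realType) (s t : R) :
  0 < t -> differentiable (fun u : R => u `^ s) t.
Proof. by move=> t0; apply/derivable1_diffP/ex_derive/is_derive1_powR. Qed.

Section chain.
Context (R : realType) (V : normedModType R).

Lemma is_derive_comp1 (g : R -> R) (f : V -> R) (x v : V) (dg : R) :
  differentiable f x -> is_derive (f x) 1 g dg ->
  is_derive x v (g \o f) (dg * 'D_v f x).
Proof.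
move=> df Dg; have dgx : differentiable g (f x).
  by apply/derivable1_diffP; exact: ex_derive.
apply: DeriveDef; first exact/diff_derivable/differentiable_comp.
rewrite deriveE; last exact: differentiable_comp.
rewrite diff_comp//= deriveE// (diff1E dgx) derive1E.
by rewrite (@derive_val _ _ _ _ _ _ _ Dg) mulrC.
Qed.

End chain.

(** * Smooth functions built from the squared distance to a pole *)

Section radial.
Context (R : realType) (N : nat) (a : 'rV[R]_N) (e : R).
Hypothesis e0 : 0 < e.

(** The squared distance is a polynomial, hence smooth at the pole too. *)
Definition sqdist (x : 'rV[R]_N) : R := dot (x - a) (x - a).

Lemma sqdist_ge0 x : 0 <= sqdist x.
Proof. by apply: sumr_ge0 => i _; rewrite -expr2 sqr_ge0. Qed.

(* An algebra of functions that is stable under partial derivatives and consists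
   of differentiable functions, hence of smooth ones. *)
Inductive radial_alg : ('rV[R]_N -> R) -> Prop :=
| radial_cst c : radial_alg (cst c)
| radial_coord i : radial_alg (fun x => x ord0 i)
| radial_add f g : radial_alg f -> radial_alg g -> radial_alg (f + g)
| radial_mul f g : radial_alg f -> radial_alg g -> radial_alg (f * g)
| radial_powR s : radial_alg (fun x => (e + sqdist x) `^ s)
| radial_flat P : radial_alg (fun x => flat P (1 - sqdist x)).

Lemma differentiable_subcoord i x :
  differentiable (fun y : 'rV[R]_N => y ord0 i - a ord0 i) x.
Proof. by apply: differentiableB => //; exact: differentiable_coord. Qed.

Lemma derive_coord i j x :
  'D_(delta_mx ord0 j) (fun y : 'rV[R]_N => y ord0 i) x = (i == j)%:R.
Proof.
apply: cvg_lim => //.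
apply: (cvg_trans (near_eq_cvg _) (cvg_cst _)); near=> h.
have h0 : h != 0 by near: h; exact: nbhs_dnbhs_neq.
by rewrite /= !mxE eqxx addrK /= [_ *: _]mulrA mulVf// mul1r.
Unshelve. all: by end_near. Qed.

Lemma sqdistE : sqdist =
  \sum_(i < N) (fun y : 'rV[R]_N => y ord0 i - a ord0 i) ^+ 2.
Proof.
apply/funext => x; rewrite /sqdist /dot fct_sumE; apply: eq_bigr => i _.
by rewrite !mxE expr2.
Qed.

Lemma differentiable_sqdist x : differentiable sqdist x.
Proof.
rewrite sqdistE; apply: differentiable_sum => i.
exact/differentiableX/differentiable_subcoord.
Qed.

Lemma partial_sqdist i x : partial i sqdist x = 2 * (x ord0 i - a ord0 i).
Proof.
have dc j : is_derive x (delta_mx ord0 i)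
    (fun y : 'rV[R]_N => y ord0 j - a ord0 j) (j == i)%:R.
  apply: DeriveDef; first exact/diff_derivable/differentiable_subcoord.
  rewrite deriveB//; last exact/diff_derivable/differentiable_coord.
  by rewrite derive_coord derive_cst subr0.
rewrite /partial sqdistE.
rewrite (@derive_val _ _ _ _ _ _ _ (is_derive_sum (fun j => is_deriveX 2 (dc j)))).
rewrite (bigD1 i)//= eqxx big1 ?addr0 => [|j /negPf ->]; last exact: scaler0.
by rewrite [LHS]mulr1 expr1.
Qed.

Lemma differentiable_radial f : radial_alg f -> forall x, differentiable f x.
Proof.
elim=> {f}[c|i|f g _ df _ dg|f g _ df _ dg|s|P] x.
- exact: differentiable_cst.
- exact: differentiable_coord.
- exact: differentiableD.
- exact: differentiableM.
- apply: (@differentiable_comp _ _ _ _ (fun y => e + sqdist y) (fun t => t `^ s)).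
    by apply: differentiableD => //; exact: differentiable_sqdist.
  by apply: differentiable_powR; rewrite ltr_pwDl// sqdist_ge0.
- apply: (@differentiable_comp _ _ _ _ (fun y => 1 - sqdist y) (flat P)).
    by apply: differentiableB => //; exact: differentiable_sqdist.
  by apply/derivable1_diffP/ex_derive/is_derive_flat.
Qed.

Lemma partial_powR i s : partial i (fun x => (e + sqdist x) `^ s) =
  (fun x => s * (e + sqdist x) `^ (s - 1) * (2 * (x ord0 i - a ord0 i))).
Proof.
apply/funext => x; rewrite -partial_sqdist.
have dg : is_derive (sqdist x) 1 (fun t => (e + t) `^ s)
    (s * (e + sqdist x) `^ (s - 1)).
  have p0 : 0 < e + sqdist x by rewrite ltr_pwDl// sqdist_ge0.
  have dl : is_derive (sqdist x) 1 (fun t => e + t) 1.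
    apply: DeriveDef; first exact: derivableD.
    by rewrite deriveD// derive_cst derive_id add0r.
  rewrite -[X in is_derive _ _ _ X]mulr1.
  exact: (@is_derive1_comp _ _ (fun t => e + t) _ _ _ (is_derive1_powR s p0) dl).
exact: (@derive_val _ _ _ _ _ _ _
  (is_derive_comp1 (delta_mx ord0 i) (differentiable_sqdist x) dg)).
Qed.

Lemma partial_flat i P : partial i (fun x => flat P (1 - sqdist x)) =
  (fun x => - flat ('X^2 * (P - P^`())) (1 - sqdist x) *
            (2 * (x ord0 i - a ord0 i))).
Proof.
apply/funext => x; rewrite -partial_sqdist.
have dg : is_derive (sqdist x) 1 (fun t => flat P (1 - t))
    (- flat ('X^2 * (P - P^`())) (1 - sqdist x)).
  have df := is_derive_flat P (1 - sqdist x).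
  have dl : is_derive (sqdist x) 1 (fun t => 1 - t) (- 1).
    apply: DeriveDef; first exact: derivableB.
    by rewrite deriveB// derive_cst derive_id sub0r.
  rewrite -mulrN1.
  exact: (@is_derive1_comp _ _ (fun t => 1 - t) _ _ _ df dl).
exact: (@derive_val _ _ _ _ _ _ _
  (is_derive_comp1 (delta_mx ord0 i) (differentiable_sqdist x) dg)).
Qed.

Lemma radial_partial i f : radial_alg f -> radial_alg (partial i f).
Proof.
have rl : radial_alg (fun x => 2 * (x ord0 i - a ord0 i)).
  apply: (@radial_mul (cst 2)); first exact: radial_cst.
  exact: (radial_add (radial_coord i) (radial_cst (- a ord0 i))).
elim=> {f}[c|j|f g rf rdf rg rdg|f g rf rdf rg rdg|s|P].
- rewrite (_ : partial i _ = cst 0); first exact: radial_cst.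
  by apply/funext => x; rewrite /partial derive_cst.
- rewrite (_ : partial i _ = cst (j == i)%:R); first exact: radial_cst.
  by apply/funext => x; rewrite /partial derive_coord.
- rewrite (_ : partial i _ = partial i f + partial i g); first exact: radial_add.
  apply/funext => x; rewrite /partial deriveD//;
    exact/diff_derivable/differentiable_radial.
- rewrite (_ : partial i _ = f * partial i g + g * partial i f).
    by apply: radial_add; exact: radial_mul.
  apply/funext => x; rewrite /partial deriveM//;
    exact/diff_derivable/differentiable_radial.
- rewrite partial_powR; apply: radial_mul => //.
  exact: (radial_mul (radial_cst s) (radial_powR (s - 1))).
- rewrite partial_flat; apply: radial_mul => //.
  rewrite (_ : (fun x => - _) = cst (- 1) *
    (fun x => flat ('X^2 * (P - P^`())) (1 - sqdist x))).
    exact: (radial_mul (radial_cst _) (radial_flat _)).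
  by apply/funext => x; rewrite fctE mulN1r.
Qed.

Lemma smooth_radial f : radial_alg f -> smooth f.
Proof.
move=> rf s; have : radial_alg (foldr (@partial R N) f s).
  by elim: s => //= i s; exact: radial_partial.
move=> /differentiable_radial df; split=> [x|i x].
  exact: differentiable_continuous.
exact: diff_derivable.
Qed.

End radial.

(** * Measurability, comparison of weighted integrals, and local integrability *)

Section weighted_integral.
Context (R : realType) (N : nat).
Implicit Types (f g : 'rV[R]_N -> R) (a x : 'rV[R]_N).
Local Notation leb := (lebesgue_rV R N).

Lemma continuous_measurable_rV f : continuous f -> measurable_fun [set: 'rV[R]_N] f.
Proof.
move=> cf; apply: (measurability _ (RGenOpens.measurableE R)).
move=> _ [_ [u [v ->]] <-].
rewrite setTI; apply: open_measurable_rV; apply: open_comp => [x _|].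
  exact: cf.
exact: interval_open.
Qed.

Lemma closed_measurable_rV (A : set 'rV[R]_N) : closed A -> measurable A.
Proof.
move=> cA; rewrite -(setCK A); apply: measurableC.
by apply: open_measurable_rV; exact: closed_openC.
Qed.

Lemma compact_measurable_rV (A : set 'rV[R]_N) : compact A -> measurable A.
Proof.
by move=> cA; apply: closed_measurable_rV; apply: compact_closed => //; exact: norm_hausdorff.
Qed.

Lemma measurable_set1_rV a : measurable [set a].
Proof.
by apply: compact_measurable_rV; exact: compact_set1.
Qed.

(** A point is a box with null sides. In dimension 0 the measure is a Dirac mass, whence [0 < N]. *)
Lemma lebesgue_rV_set1 a : (0 < N)%N -> leb [set a] = 0%E.
Proof.
move=> N0; rewrite (_ : [set a] =
    [set v : 'rV[R]_N | forall i, [set a ord0 i] (v ord0 i)]); last first.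
  by apply/seteqP; split=> [v -> //|v va]; apply/rowP => i; exact: va.
rewrite (@lebesgue_rV_box R N (fun i => [set a ord0 i])) => [|i]; last exact: measurable_set1.
rewrite (bigD1 (Ordinal N0))//= lebesgue_measure_set1 mul0e//.
Qed.

(** On nonnegative reals the inverse is the power of exponent -1, also at 0, where both are 0. *)
Lemma measurable_funV_ge0 f : measurable_fun setT f -> (forall x, 0 <= f x) ->
  measurable_fun [set: 'rV[R]_N] (fun x => (f x)^-1).
Proof.
move=> mf f0; under eq_fun do rewrite -powR_inv1//.
exact: (measurableT_comp (measurable_powR _)).
Qed.

Lemma enorm_sqr (x : 'rV[R]_N) : enorm x ^+ 2 = dot x x.
Proof.
by rewrite sqr_sqrtr//; apply: sumr_ge0 => i _; rewrite -expr2 sqr_ge0.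
Qed.

(** Turns the exponents of [hypothesis_H3] into exponents of [sqdist]; the two conventions at
    [x = a] agree. *)
Lemma powR_enormV a x (t : R) :
  (enorm (x - a) `^ t)^-1 = sqdist a x `^ (- (t / 2)).
Proof.
rewrite /enorm -/(sqdist a x) -powR12_sqrt ?sqdist_ge0//.
by rewrite -powRN -powRrM mulrN mulrC.
Qed.

Lemma measurable_sqdist a : measurable_fun setT (sqdist a).
Proof.
apply: continuous_measurable_rV => x.
exact/differentiable_continuous/differentiable_sqdist.
Qed.

Context (mu : 'rV[R]_N -> R) (mu_ge0 : forall x, 0 <= mu x)
  (mmu : measurable_fun setT mu).

Lemma int_mu_ge0 f : (forall x, 0 <= f x) -> (0 <= int_mu mu f)%E.
Proof. by move=> f0; apply: integral_ge0 => x _; rewrite lee_fin mulr_ge0. Qed.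

Lemma measurable_mul_mu f : measurable_fun setT f ->
  measurable_fun setT (fun x => (f x * mu x)%:E).
Proof. by move=> mf; apply/measurable_EFinP; exact: measurable_funM. Qed.

Lemma int_muD f g : measurable_fun setT f -> measurable_fun setT g ->
  (forall x, 0 <= f x) -> (forall x, 0 <= g x) ->
  (int_mu mu (fun x => f x + g x)%R = int_mu mu f + int_mu mu g)%E.
Proof.
move=> mf mg f0 g0; rewrite /int_mu -ge0_integralD//.
- by apply: eq_integral => x _; rewrite mulrDl EFinD.
- by move=> x _; rewrite lee_fin mulr_ge0.
- exact: measurable_mul_mu.
- by move=> x _; rewrite lee_fin mulr_ge0.
- exact: measurable_mul_mu.
Qed.

Lemma int_muZ c f : measurable_fun setT f -> (forall x, 0 <= f x) -> 0 <= c ->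
  (int_mu mu (fun x => c * f x)%R = c%:E * int_mu mu f)%E.
Proof.
move=> mf f0 c0; rewrite /int_mu -ge0_integralZl_EFin//.
- by apply: eq_integral => x _; rewrite -mulrA EFinM.
- by move=> x _; rewrite lee_fin mulr_ge0.
- exact: measurable_mul_mu.
Qed.

Lemma le_int_mu f g : measurable_fun setT f -> measurable_fun setT g ->
  (forall x, 0 <= f x) -> (forall x, f x <= g x) ->
  (int_mu mu f <= int_mu mu g)%E.
Proof.
move=> mf mg f0 fg; apply: ge0_le_integral => //.
- by move=> x _; rewrite lee_fin mulr_ge0.
- exact: measurable_mul_mu.
- exact: measurable_mul_mu.
- by move=> x _; rewrite lee_fin ler_wpM2r.
Qed.

(** The pole is a null set. Discarding it is necessary where [g] is a negative power of the
    distance, since such a power takes the value 0 at [a]. *)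
Lemma le_int_mu_setC1 a f g : (0 < N)%N ->
  measurable_fun setT f -> measurable_fun setT g ->
  (forall x, 0 <= f x) -> (forall x, 0 <= g x) ->
  (forall x, x != a -> f x <= g x) ->
  (int_mu mu f <= int_mu mu g)%E.
Proof.
move=> N0 mf mg f0 g0 fg; apply: ae_ge0_le_integral => //.
- by move=> x _; rewrite lee_fin mulr_ge0.
- exact: measurable_mul_mu.
- by move=> x _; rewrite lee_fin mulr_ge0.
- exact: measurable_mul_mu.
exists [set a]; split; [exact: measurable_set1_rV|exact: lebesgue_rV_set1|].
move=> x /= nle; apply: contra_notP nle => /eqP xa _.
by rewrite lee_fin ler_wpM2r// fg.
Qed.

Lemma integral_abs_mu (K : set 'rV[R]_N) f : (forall x, 0 <= f x) ->
  (\int[leb]_(x in K) `|(f x * mu x)%:E| =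
   int_mu mu (fun x => f x * \1_K x)%R)%E.
Proof.
move=> f0; rewrite integral_mkcond; apply: eq_integral => x _.
rewrite patchE indicE; case: ifPn => _; last by rewrite mulr0 mul0r.
by rewrite mulr1/= ger0_norm// mulr_ge0.
Qed.

Lemma loc_integrable_mu_fin f (K : set 'rV[R]_N) : (forall x, 0 <= f x) ->
  loc_integrable_mu mu f -> compact K ->
  (int_mu mu (fun x => f x * \1_K x)%R < +oo)%E.
Proof.
by move=> f0 [_ lf] cK; rewrite -integral_abs_mu//; exact: lf.
Qed.

Lemma measurable_mul_indic f (K : set 'rV[R]_N) : measurable K ->
  measurable_fun setT f -> measurable_fun setT (fun x => f x * \1_K x).
Proof. by move=> mK mf; apply: measurable_funM => //; exact: measurable_indic. Qed.

(** Local integrability of [mu] takes care of the constant [c], so [g] need only dominate where [f]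
    is large. *)
Lemma loc_integrable_mu_le (c : R) f g : 0 <= c ->
  measurable_fun setT f -> measurable_fun setT g ->
  (forall x, 0 <= f x) -> (forall x, 0 <= g x) ->
  (forall x, f x <= c + g x) -> loc_integrable (EFin \o mu) ->
  (forall K, compact K -> (int_mu mu (fun x => g x * \1_K x)%R < +oo)%E) ->
  loc_integrable_mu mu f.
Proof.
move=> c0 mf mg f0 g0 fg [_ lmu] lg; split=> [|K cK].
  exact: measurable_mul_mu.
rewrite integral_abs_mu//; have mK := compact_measurable_rV cK.
have i0 x : 0 <= (\1_K : _ -> R) x by rewrite indicE.
have m1 : measurable_fun setT (\1_K : 'rV[R]_N -> R) by exact: measurable_indic.
have mg1 := measurable_mul_indic mK mg.
have mf1 := measurable_mul_indic mK mf.
have l1 : (int_mu mu \1_K < +oo)%E.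
  rewrite (_ : \1_K = (fun x => 1 * \1_K x)); last first.
    by apply/funext => x; rewrite mul1r.
  rewrite -(@integral_abs_mu K (cst 1))//.
  by under eq_integral do rewrite mul1r; exact: lmu.
apply: (@le_lt_trans _ _
    (int_mu mu (fun x => c * \1_K x + g x * \1_K x)%R)).
  apply: le_int_mu => //.
  - by apply: measurable_funD => //; exact: measurable_funM.
  - by move=> x; rewrite mulr_ge0.
  - by move=> x; rewrite -mulrDl ler_wpM2r.
rewrite int_muD//.
- rewrite int_muZ// lte_add_pinfty ?lg//.
  by rewrite lte_mul_pinfty ?lee_fin.
- exact: measurable_funM.
- by move=> x; rewrite mulr_ge0.
- by move=> x; rewrite mulr_ge0.
Qed.

End weighted_integral.

(** Young's inequality: the difference of the two sides is a multiple of a square. *)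
Lemma sqr_add_le (R : realFieldType) (lam X Y : R) : 0 < lam ->
  (X + Y) ^+ 2 <= (1 + lam) * X ^+ 2 + (1 + lam^-1) * Y ^+ 2.
Proof.
move=> l0; rewrite -subr_ge0.
rewrite (_ : _ - _ = lam^-1 * (lam * X - Y) ^+ 2).
  by rewrite mulr_ge0 ?sqr_ge0// invr_ge0 ltW.
by field; rewrite gt_eqF.
Qed.

(** * The regularized, truncated test functions and their pointwise energy *)

Section hardy_test.
Context (R : realType) (N : nat) (a : 'rV[R]_N).
Local Notation q := (sqdist a).

Definition cutoff (u : R) : R := flat 1 u.
(* The derivative of [cutoff], by [is_derive_flat]. *)
Definition cutoff' (u : R) : R := flat ('X^2 * (1 - 1^`())) u.

Lemma cutoffE u : 0 < u -> cutoff u = expR (- u^-1).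
Proof. by move=> u0; rewrite /cutoff /flat u0 hornerE mul1r. Qed.

Lemma cutoff_le0 u : u <= 0 -> cutoff u = 0.
Proof. by move=> u0; rewrite /cutoff /flat ltNge u0. Qed.

Lemma cutoff_ge0 u : 0 <= cutoff u.
Proof.
by have [u0|u0] := leP u 0; [rewrite cutoff_le0|rewrite cutoffE// expR_ge0].
Qed.

Lemma cutoff_sqr_le u : cutoff (1 - u) ^+ 2 <= (u <= 1)%R%:R.
Proof.
have [u1|u1] := leP u 1; last first.
  by rewrite cutoff_le0 ?expr0n// subr_le0 ltW.
rewrite expr_le1 ?cutoff_ge0//.
have [u0|u0] := leP (1 - u) 0; first by rewrite cutoff_le0.
by rewrite cutoffE// expR_le1 oppr_le0 invr_ge0 ltW.
Qed.

(** The derivative is [y^2 exp(-y)] at [y = 1/(1 - u)], hence at most [2! = 2]. *)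
Lemma cutoff'_sqr_le u : cutoff' (1 - u) ^+ 2 <= 4 * (u <= 1)%R%:R.
Proof.
rewrite /cutoff' /flat subr_gt0; have [u1|u1] := leP 1 u.
  by rewrite expr0n/= mulr_ge0.
rewrite (ltW u1) mulr1 !hornerE/= derivC hornerE subr0 mulr1.
set y := (1 - u)^-1; have y0 : 0 <= y by rewrite invr_ge0 subr_ge0 ltW.
have : y ^+ 2 * expR (- y) <= 2 := exprn_le_expR 2 y0.
have : 0 <= y ^+ 2 * expR (- y) by rewrite mulr_ge0 ?expR_ge0// exprn_ge0.
nra.
Qed.

(** Here [1/(1 - u) <= 2], and squaring doubles the exponent. *)
Lemma cutoff_sqr_ge u : u <= 1 / 2 -> expR (- 4) <= cutoff (1 - u) ^+ 2.
Proof.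
move=> u2; have u0 : 0 < 1 - u by lra.
rewrite cutoffE// -expRM_natl ler_expR.
have : (1 - u)^-1 <= 2 by rewrite invf_ple ?posrE//; lra.
lra.
Qed.

Section fixed_eps.
Context (e s : R) (e0 : 0 < e) (s0 : 0 < s).

Definition hardy_fun x := (e + q x) `^ (- (s / 2)) * cutoff (1 - q x).

Let p x := e + q x.
Let p0 x : 0 < p x. Proof. by rewrite ltr_pwDl// sqdist_ge0. Qed.

Lemma radial_hardy_fun : radial_alg a e hardy_fun.
Proof. exact: (radial_mul (radial_powR a e _) (radial_flat a e _)). Qed.

Lemma partial_hardy_fun i x : partial i hardy_fun x =
  - ((s / 2) * (cutoff (1 - q x) / (e + q x)) + cutoff' (1 - q x)) *
  (e + q x) `^ (- (s / 2)) * (2 * (x ord0 i - a ord0 i)).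
Proof.
have dr f : radial_alg a e f -> derivable f x (delta_mx ord0 i).
  by move=> rf; exact: diff_derivable (differentiable_radial e0 rf x).
rewrite {1}/partial (_ : hardy_fun = (fun x => (e + q x) `^ (- (s / 2))) *
  (fun x => flat 1 (1 - q x)))// deriveM; last 2 first.
- exact/dr/radial_powR.
- exact/dr/radial_flat.
rewrite -/(partial i (fun x => flat 1 (1 - q x)) x).
rewrite -/(partial i (fun x => (e + q x) `^ (- (s / 2))) x).
rewrite partial_flat partial_powR// -/(cutoff' _) -/(cutoff _) /=.
have -> : (e + q x) `^ (- (s / 2) - 1) = (e + q x) `^ (- (s / 2)) / (e + q x).
  have px : 0 < e + q x := p0 x.
  by rewrite powRB ?powRr1 ?ltW// (gt_eqF px) implybT.
rewrite /GRing.scale/=; ring.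
Qed.

Lemma powR_half_sqr x : ((e + q x) `^ (- (s / 2))) ^+ 2 = (e + q x) `^ (- s).
Proof.
rewrite expr2 -powRD; first by congr (_ `^ _); lra.
by rewrite (gt_eqF (p0 x)) implybT.
Qed.

Lemma hardy_fun_sqr x :
  hardy_fun x ^+ 2 = (e + q x) `^ (- s) * cutoff (1 - q x) ^+ 2.
Proof. by rewrite exprMn powR_half_sqr. Qed.

(** The factor [4 * q x] is the squared norm of the gradient [2 (x - a)] of [q]. *)
Lemma enorm_grad_hardy_fun x : enorm (grad hardy_fun x) ^+ 2 =
  4 * q x * ((s / 2) * (cutoff (1 - q x) / (e + q x)) + cutoff' (1 - q x)) ^+ 2 *
  (e + q x) `^ (- s).
Proof.
rewrite enorm_sqr /dot -powR_half_sqr [in RHS]/sqdist /dot mulr_sumr !mulr_suml.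
apply: eq_bigr => i _; rewrite !mxE partial_hardy_fun; ring.
Qed.

(** Young's inequality separates the derivative of the power, controlled by
    [Q / (e + Q)^2 <= 1 / Q], from that of the cutoff, which is bounded and vanishes for [Q > 1]. *)
Lemma energy_le (lam : R) x : 0 < lam ->
  enorm (grad hardy_fun x) ^+ 2 <=
  (1 + lam) * s ^+ 2 * (hardy_fun x ^+ 2 / q x) +
  16 * (1 + lam^-1) * ((e + q x) `^ (- s) * (q x <= 1)%R%:R).
Proof.
move=> l0; rewrite enorm_grad_hardy_fun hardy_fun_sqr.
have P0 := powR_ge0 (e + q x) (- s); set P := _ `^ _ in P0 *.
have := cutoff'_sqr_le (q x); set B' := cutoff' _ => B'1; set B := cutoff _.
set Q := q x in B'1 *; have Q0 : 0 <= Q by exact: sqdist_ge0.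
have pQ := p0 x; rewrite /p -/Q in pQ.
rewrite (_ : _ + 16 * _ * _ = ((1 + lam) * (s ^+ 2 * (B ^+ 2 / Q)) +
  (1 + lam^-1) * (16 * (Q <= 1)%R%:R)) * P); last by ring.
apply: ler_wpM2r => //.
have -> : 4 * Q * (s / 2 * (B / (e + Q)) + B') ^+ 2 =
  Q * (s * (B / (e + Q)) + 2 * B') ^+ 2 by field; rewrite gt_eqF.
apply: le_trans (ler_wpM2l Q0 (sqr_add_le _ _ l0)) _.
have lV : 0 < 1 + lam^-1 by rewrite addr_gt0// invr_gt0.
rewrite mulrDr; apply: lerD.
  rewrite mulrCA ler_wpM2l ?addr_ge0// ?(ltW l0)//.
  rewrite (_ : Q * _ = s ^+ 2 * (B ^+ 2 * (Q * (e + Q)^-1 ^+ 2))); last by ring.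
  rewrite !ler_wpM2l ?sqr_ge0//.
  (* At the pole both sides are 0, since [0^-1 = 0]. *)
  have [->|QN0] := eqVneq Q 0; first by rewrite mul0r invr0.
  have {QN0} Q0' : 0 < Q by rewrite lt_def QN0.
  rewrite -ler_pdivlMl// exprVn -invfM -expr2 lef_pV2 ?posrE ?exprn_gt0//.
  by rewrite ler_sqr ?nnegrE ?(ltW pQ)// lerDr ltW.
(* The constant 16 is [2^2] times the bound 4 on the square of [cutoff']. *)
rewrite mulrCA ler_wpM2l ?(ltW lV)// exprMn.
case: (leP Q 1) B'1 => Q1; rewrite /= ?mulr1 ?mulr0; move: (B' ^+ 2) => b b1; nra.
Qed.

(** The closed Euclidean ball is a closed subset of a product of segments. *)
Lemma compact_sqdist_ball : compact [set x | q x <= 1].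
Proof.
apply: (@subclosed_compact _ _ [set v : 'rV[R]_N |
    forall i, `[a ord0 i - 1, a ord0 i + 1]%classic (v ord0 i)]).
- apply: (@closed_comp _ _ q [set t | t <= 1]) => [x _|].
    exact/differentiable_continuous/differentiable_sqdist.
  exact: closed_le.
- by apply: (@rV_compact _ _ (fun i => `[a ord0 i - 1, a ord0 i + 1]%classic)) => i;
    exact: segment_compact.
move=> x /= qx i; have : (x ord0 i - a ord0 i) ^+ 2 <= 1.
  apply: le_trans qx; rewrite /sqdist /dot (bigD1 i)//= !mxE -expr2 lerDl.
  by apply: sumr_ge0 => j _; rewrite -expr2 sqr_ge0.
by rewrite in_itv/= => h; apply/andP; split; nra.
Qed.

Lemma test_hardy_fun : test_function hardy_fun.
Proof.
split; first exact: (smooth_radial e0 radial_hardy_fun).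
apply: (subclosed_compact (@closed_closure _ _) compact_sqdist_ball).
rewrite closureE => x; apply; split => /=.
  exact: compact_closed (@norm_hausdorff _ _) compact_sqdist_ball.
move=> y /=; apply: contraNT; rewrite -ltNge => qy.
by rewrite /hardy_fun cutoff_le0 ?mulr0// subr_le0 ltW.
Qed.

End fixed_eps.

End hardy_test.

(** * Local integrability of powers of the distance to the pole *)

Section hardy_energy.
Context (R : realType) (N : nat) (a : 'rV[R]_N).
Local Notation q := (sqdist a).
Local Notation K := [set x | q x <= 1].
Context (mu : 'rV[R]_N -> R) (mu_ge0 : forall x, 0 <= mu x)
  (lmu : loc_integrable (EFin \o mu)) (N_gt0 : (0 < N)%N).

Let mmu : measurable_fun setT mu.
Proof. by case: lmu => /measurable_EFinP. Qed.

Lemma sqdist_gt0 x : x != a -> 0 < q x.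
Proof.
move=> xa; rewrite lt_def sqdist_ge0 andbT; apply: contra xa => /eqP q0.
apply/eqP/rowP => i; apply/eqP; rewrite -subr_eq0 -sqrf_eq0 expr2.
have /psumr_eq0P : \sum_(i < N) (x - a) ord0 i * (x - a) ord0 i = 0 by [].
move=> /(_ _ i isT); rewrite !mxE => ->// j _.
by rewrite -expr2 sqr_ge0.
Qed.

Lemma indic_ballE x : (\1_K : _ -> R) x = (q x <= 1)%R%:R.
Proof.
by rewrite indicE; congr (_%:R); congr nat_of_bool; apply/idP/idP; rewrite inE.
Qed.

Lemma measurable_sqdist_powR t : measurable_fun setT (fun x => q x `^ t).
Proof. exact: (measurableT_comp (measurable_powR _) (measurable_sqdist a)). Qed.

(** Where [q <= 1] the larger exponent dominates; elsewhere the constant 1 does. *)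
Lemma loc_integrable_pole_le (t t' : R) : 0 < t -> t <= t' ->
  loc_integrable_mu mu (fun x => q x `^ (- t')) ->
  loc_integrable_mu mu (fun x => q x `^ (- t)).
Proof.
move=> t0 tt' lt'.
apply: (loc_integrable_mu_le mu_ge0 mmu (c := 1) (g := fun x => q x `^ (- t'))) => //.
- exact: measurable_sqdist_powR.
- exact: measurable_sqdist_powR.
- by move=> x; exact: powR_ge0.
- by move=> x; exact: powR_ge0.
- move=> x; have := sqdist_ge0 a x; rewrite le_eqVlt => /predU1P[<-|q0].
    by rewrite powR0 ?oppr_eq0 ?gt_eqF// addr_ge0// powR_ge0.
  have [q1|q1] := leP (q x) 1.
    by rewrite -[leLHS]add0r lerD// ger_powR ?q0// lerN2.
  rewrite -[leLHS]addr0 lerD ?powR_ge0// -(powRr0 (q x)).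
  by rewrite ler_powR ?(ltW q1)// oppr_le0 ltW.
- by move=> L cL; apply: loc_integrable_mu_fin => // x; exact: powR_ge0.
Qed.

Context (s : R) (s0 : 0 < s).
Local Notation phi e := (hardy_fun a e s).

Lemma powRN_shift_le (e Q : R) : 0 < e -> 0 < Q -> (e + Q) `^ (- s) <= Q `^ (- s).
Proof.
move=> e0 Q0; rewrite !powRN lef_pV2 ?posrE ?powR_gt0 ?addr_gt0//.
by rewrite ge0_ler_powR ?nnegrE ?ltW ?addr_gt0// ltrDr.
Qed.

Lemma measurable_radial (e : R) f : 0 < e -> radial_alg a e f -> measurable_fun setT f.
Proof.
move=> e0 rf; apply: continuous_measurable_rV => x.
exact/differentiable_continuous/(differentiable_radial e0 rf).
Qed.

Lemma measurable_hardy_fun (e : R) : 0 < e -> measurable_fun setT (phi e).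
Proof. by move=> e0; apply: (measurable_radial e0); exact: radial_hardy_fun. Qed.

Lemma measurable_partial_hardy_fun (e : R) i : 0 < e ->
  measurable_fun setT (partial i (phi e)).
Proof.
move=> e0; apply: (measurable_radial e0); apply: radial_partial => //.
exact: radial_hardy_fun.
Qed.

Lemma measurable_energy (e : R) : 0 < e ->
  measurable_fun setT (fun x => enorm (grad (phi e) x) ^+ 2).
Proof.
move=> e0; under eq_fun do rewrite enorm_sqr.
apply: measurable_sum => i; under eq_fun do rewrite !mxE.
by apply: measurable_funM; exact: measurable_partial_hardy_fun.
Qed.

Lemma measurable_hardy_quot (e : R) b : 0 < e ->
  measurable_fun setT (fun x => phi e x ^+ 2 / sqdist b x).
Proof.
move=> e0; apply: measurable_funM.
  by apply: measurable_funX; exact: measurable_hardy_fun.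
apply: measurable_funV_ge0 => [|x]; [exact: measurable_sqdist|exact: sqdist_ge0].
Qed.

(** * Weighted integrals of the test functions and their limit as [e] tends to 0 *)

Context (ls : loc_integrable_mu mu (fun x => q x `^ (- s)))
  (l1 : loc_integrable_mu mu (fun x => q x `^ (- 1))).

Let cK : compact K. Proof. exact: compact_sqdist_ball. Qed.
Let mK : measurable K. Proof. exact: compact_measurable_rV. Qed.

Let J := int_mu mu (fun x => q x `^ (- s) * \1_K x).

Let J_lt : (J < +oo)%E.
Proof. by apply: loc_integrable_mu_fin => // x; exact: powR_ge0. Qed.

Let mJ : measurable_fun setT (fun x => q x `^ (- s) * \1_K x).
Proof. by apply: measurable_mul_indic => //; exact: measurable_sqdist_powR. Qed.

Let J_fun_ge0 x : 0 <= q x `^ (- s) * \1_K x.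
Proof. by rewrite mulr_ge0 ?powR_ge0// indic_ballE. Qed.

Lemma int_hardy_fun_sqr_le (e : R) : 0 < e ->
  (int_mu mu (fun x => (phi e x ^+ 2)%R) <= J)%E.
Proof.
move=> e0; apply: (le_int_mu_setC1 mu_ge0 mmu (a := a)) => //.
- by apply: measurable_funX; exact: measurable_hardy_fun.
- by move=> x; exact: sqr_ge0.
move=> x /sqdist_gt0 q0; rewrite hardy_fun_sqr// indic_ballE.
rewrite ler_pM ?powR_ge0 ?sqr_ge0 ?powRN_shift_le//; exact: cutoff_sqr_le.
Qed.

(** For fixed [e] the factor [(e + q)^(-s)] is at most [e^(-s)], which leaves [q^(-1)] on the unit
    ball. The bound degenerates as [e] tends to 0, but finiteness is enough for the later
    absorption. *)
Lemma int_hardy_quot_lt (e : R) : 0 < e ->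
  (int_mu mu (fun x => (phi e x ^+ 2 / q x)%R) < +oo)%E.
Proof.
move=> e0; apply: (@le_lt_trans _ _
  (int_mu mu (fun x => e `^ (- s) * (q x `^ (- 1) * \1_K x))%R)).
  apply: le_int_mu => //.
  - exact: measurable_hardy_quot.
  - apply: measurable_funM => //; apply: measurable_mul_indic => //.
    exact: measurable_sqdist_powR.
  - by move=> x; rewrite divr_ge0 ?sqr_ge0 ?sqdist_ge0.
  move=> x; rewrite hardy_fun_sqr// indic_ballE powR_inv1 ?sqdist_ge0//.
  rewrite -mulrA [_ / q x]mulrC ler_pM ?powR_ge0//.
  - by rewrite mulr_ge0 ?sqr_ge0// invr_ge0 sqdist_ge0.
  - rewrite !powRN lef_pV2 ?posrE ?powR_gt0 ?ltr_pwDl ?sqdist_ge0//.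
    have eq0 : 0 < e + q x by rewrite ltr_pwDl// sqdist_ge0.
    by rewrite ge0_ler_powR ?nnegrE ?(ltW s0) ?(ltW e0) ?(ltW eq0)// lerDl sqdist_ge0.
  - by rewrite ler_wpM2l ?invr_ge0 ?sqdist_ge0//; exact: cutoff_sqr_le.
rewrite int_muZ ?powR_ge0//.
- rewrite lte_mul_pinfty ?lee_fin ?powR_ge0//.
  by apply: loc_integrable_mu_fin => // x; exact: powR_ge0.
- by apply: measurable_mul_indic => //; exact: measurable_sqdist_powR.
- by move=> x; rewrite mulr_ge0 ?powR_ge0// indic_ballE.
Qed.

Lemma int_energy_le (e lam : R) : 0 < e -> 0 < lam ->
  (int_mu mu (fun x => (enorm (grad (phi e) x) ^+ 2)%R) <=
   ((1 + lam) * s ^+ 2)%:E * int_mu mu (fun x => (phi e x ^+ 2 / q x)%R) +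
   (16 * (1 + lam^-1))%:E * J)%E.
Proof.
move=> e0 l0.
have A0 x : 0 <= phi e x ^+ 2 / q x by rewrite divr_ge0 ?sqr_ge0 ?sqdist_ge0.
have c10 : 0 <= (1 + lam) * s ^+ 2 by rewrite mulr_ge0 ?sqr_ge0// addr_ge0// ltW.
have c20 : 0 <= 16 * (1 + lam^-1) by rewrite mulr_ge0// addr_ge0// invr_ge0 ltW.
have mA := measurable_hardy_quot a e0.
rewrite -!int_muZ// -int_muD//; last 4 first.
- exact: measurable_funM.
- exact: measurable_funM.
- by move=> x; rewrite mulr_ge0.
- by move=> x; rewrite mulr_ge0.
apply: (le_int_mu_setC1 mu_ge0 mmu (a := a)) => //.
- exact: measurable_energy.
- by apply: measurable_funD; exact: measurable_funM.
- by move=> x; exact: sqr_ge0.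
- by move=> x; rewrite addr_ge0// mulr_ge0.
move=> x /sqdist_gt0 q0; apply: le_trans (energy_le a s e0 x l0) _.
rewrite lerD2l ler_wpM2l// indic_ballE.
by rewrite ler_wpM2r// powRN_shift_le.
Qed.

(** Being itself a test function, [phi e] is approximated by a constant sequence. *)
Lemma H1_mu_hardy_fun (e : R) : 0 < e -> H1_mu mu (phi e) (grad (phi e)).
Proof.
move=> e0; split.
- split; first exact: measurable_hardy_fun.
  exact: le_lt_trans (int_hardy_fun_sqr_le e0) J_lt.
- move=> i; split.
    by under eq_fun do rewrite mxE; exact: measurable_partial_hardy_fun.
  apply: (@le_lt_trans _ _ (int_mu mu (fun x => (enorm (grad (phi e) x) ^+ 2)%R))).
    apply: le_int_mu => //.
    + apply: measurable_funX; under eq_fun do rewrite mxE.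
      exact: measurable_partial_hardy_fun.
    + exact: measurable_energy.
    + by move=> x; exact: sqr_ge0.
    move=> x; rewrite enorm_sqr /dot (bigD1 i)//= -expr2 lerDl.
    by apply: sumr_ge0 => j _; rewrite -expr2 sqr_ge0.
  apply: le_lt_trans (int_energy_le e0 ltr01) _.
  rewrite lte_add_pinfty// lte_mul_pinfty ?lee_fin//.
  + by rewrite mulr_ge0 ?sqr_ge0.
  + exact: int_hardy_quot_lt.
exists (fun=> phi e); split=> [_|]; first exact: test_hardy_fun.
rewrite (_ : (fun=> _) = cst 0%E); first exact: cvg_cst.
apply/funext => k; rewrite /int_mu !integral0_eq ?adde0// => x _.
  rewrite (_ : enorm _ = 0) ?expr0n ?mul0r// subrr /enorm /dot big1 ?sqrtr0//.
  by move=> i _; rewrite mxE mul0r.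
by rewrite subrr expr0n mul0r.
Qed.

(** The quotient integral in the energy bound has a coefficient below [c], so it is absorbed by the
    left-hand side; its finiteness makes the subtraction legitimate. *)
Lemma hardy_quot_bounded (c k : R) : s ^+ 2 < c ->
  (forall e, 0 < e ->
    (c%:E * int_mu mu (fun x => (phi e x ^+ 2 / q x)%R) <=
     int_mu mu (fun x => (enorm (grad (phi e) x) ^+ 2)%R) +
     k%:E * int_mu mu (fun x => (phi e x ^+ 2)%R))%E) ->
  exists M : R, forall e, 0 < e ->
    (int_mu mu (fun x => (phi e x ^+ 2 / q x)%R) <= M%:E)%E.
Proof.
move=> sc hardy; have s20 : 0 < s ^+ 2 by rewrite exprn_gt0.
(* Chosen so that [(1 + lam) * s ^+ 2] is the midpoint of [s ^+ 2] and [c]. *)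
pose lam := (c - s ^+ 2) / (2 * s ^+ 2).
have l0 : 0 < lam by rewrite divr_gt0 ?subr_gt0// mulr_gt0.
have lamE : (1 + lam) * s ^+ 2 = (c + s ^+ 2) / 2.
  by rewrite /lam; field; rewrite gt_eqF.
have J0 : (0 <= J)%E by exact: int_mu_ge0.
pose j := fine J; have jE : J = j%:E by rewrite fineK// ge0_fin_numE.
have j0 : 0 <= j by rewrite -lee_fin -jE.
(* The divisor is the coefficient left after absorption; the absolute value allows either sign of
   [k]. *)
exists ((16 * (1 + lam^-1) + `|k|) * j / ((c - s ^+ 2) / 2)) => e e0.
have := hardy e e0; have := int_energy_le e0 l0; rewrite lamE jE.
have := int_hardy_quot_lt e0; have := int_hardy_fun_sqr_le e0; rewrite jE.
have : (0 <= int_mu mu (fun x => (phi e x ^+ 2)%R))%E.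
  by apply: int_mu_ge0 => // x; exact: sqr_ge0.
have : (0 <= int_mu mu (fun x => (phi e x ^+ 2 / q x)%R))%E.
  by apply: int_mu_ge0 => // x; rewrite divr_ge0 ?sqr_ge0 ?sqdist_ge0.
have : (0 <= int_mu mu (fun x => (enorm (grad (phi e) x) ^+ 2)%R))%E.
  by apply: int_mu_ge0 => // x; exact: sqr_ge0.
(* The collected bounds exclude infinite values, so the rest is real arithmetic. *)
move: (int_mu _ _) (int_mu _ _) (int_mu _ _) => [F| |] [A| |] [E| |]//.
rewrite -?EFinM -?EFinD !lee_fin => E0 A0 F0 Fj _ EA cA.
rewrite ler_pdivlMr; last by rewrite divr_gt0// subr_gt0.
have : k * F <= `|k| * j.
  apply: le_trans (ler_wpM2r F0 (ler_norm k)) _.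
  by rewrite ler_wpM2l.
nra.
Qed.

(** The sets [q >= 1/(k+1)] increase to the complement of the pole. On each of them the bound for
    [e = 1/(k+1)] controls the limit integrand up to the factor [2^s], and monotone convergence
    concludes. *)
Lemma hardy_quot_limit (M : R) :
  (forall e, 0 < e -> (int_mu mu (fun x => (phi e x ^+ 2 / q x)%R) <= M%:E)%E) ->
  (int_mu mu (fun x => (q x `^ (- (s + 1)) * cutoff (1 - q x) ^+ 2)%R) < +oo)%E.
Proof.
move=> AM; pose g x := q x `^ (- (s + 1)) * cutoff (1 - q x) ^+ 2.
pose h x := (g x * mu x)%:E.
pose F (k : nat) := [set x | k.+1%:R^-1 <= q x].
have mg : measurable_fun setT g.
  apply: measurable_funM; first exact: measurable_sqdist_powR.
  apply: measurable_funX; apply: (@measurable_radial 1) => //.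
  exact: radial_flat.
have g0 x : 0 <= g x by rewrite mulr_ge0 ?powR_ge0 ?sqr_ge0.
have h0 x : (0 <= h x)%E by rewrite lee_fin mulr_ge0.
have mh : measurable_fun setT h by exact: measurable_mul_mu.
have mF k : measurable (F k).
  apply: closed_measurable_rV.
  apply: (@closed_comp _ _ q [set t | k.+1%:R^-1 <= t]) => [x _|].
    exact/differentiable_continuous/differentiable_sqdist.
  exact: closed_ge.
(* On [F k] one has [e + q <= 2 q] for [e = 1 / (k + 1)]. *)
have int_F k : (\int[lebesgue_rV R N]_(x in F k) h x <= (2 `^ s * M)%:E)%E.
  set e : R := k.+1%:R^-1; have e0 : 0 < e by rewrite invr_gt0.
  have A0 x : 0 <= phi e x ^+ 2 / q x by rewrite divr_ge0 ?sqr_ge0 ?sqdist_ge0.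
  apply: (@le_trans _ _
      ((2 `^ s)%:E * int_mu mu (fun x => (phi e x ^+ 2 / q x)%R))%E); last first.
    by rewrite EFinM lee_wpmul2l ?lee_fin ?powR_ge0// AM.
  have mA := measurable_hardy_quot a e0.
  rewrite -int_muZ ?powR_ge0// integral_mkcond; apply: ge0_le_integral => //.
  - by move=> x _; rewrite patchE; case: ifPn.
  - by apply/(measurable_restrictT _ _).1 => //; exact: measurable_funTS.
  - exact: (measurable_mul_mu mmu (measurable_funM (measurable_cst (2 `^ s)) mA)).
  move=> x _; rewrite patchE; case: ifPn => [|_]; last first.
    by rewrite lee_fin mulr_ge0// mulr_ge0 ?powR_ge0.
  rewrite inE /F/= -/e => eq; have q0 : 0 < q x by exact: lt_le_trans eq.
  rewrite lee_fin ler_wpM2r// hardy_fun_sqr// /g.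
  rewrite (_ : 2 `^ s * _ = 2 `^ s * (e + q x) `^ (- s) * (q x)^-1 *
    cutoff (1 - q x) ^+ 2); last by ring.
  rewrite ler_wpM2r ?sqr_ge0// opprD powRD; last first.
    by rewrite (gt_eqF q0) implybT.
  rewrite powR_inv1 ?(ltW q0)// ler_wpM2r ?invr_ge0 ?(ltW q0)//.
  (* Reduces the comparison to [e + q <= 2 q] under a decreasing power. *)
  have -> : q x `^ (- s) = 2 `^ s * (2 * q x) `^ (- s).
    rewrite powRM ?(ltW q0)// mulrA -powRD ?subrr ?powRr0 ?mul1r//.
    by rewrite pnatr_eq0 implybT.
  rewrite ler_wpM2l ?powR_ge0// !powRN lef_pV2 ?posrE ?powR_gt0 ?addr_gt0//.
    rewrite ge0_ler_powR ?nnegrE ?(ltW s0) ?addr_ge0 ?(ltW e0) ?(ltW q0)//.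
      by rewrite mulr_ge0 ?(ltW q0).
    by rewrite mulr_natl mulr2n lerD2r.
  by rewrite mulr_gt0.
have ndF : nondecreasing_seq F.
  move=> k l kl; apply/subsetPset => x /=; apply: le_trans.
  by rewrite lef_pV2 ?posrE// ler_nat.
(* Outside the union [q] is 0, and so is its power of nonzero exponent; nothing is lost. *)
have UF : int_mu mu g = (\int[lebesgue_rV R N]_(x in \bigcup_k F k) h x)%E.
  rewrite [RHS]integral_mkcond; apply: eq_integral => x _.
  rewrite patchE; case: ifPn => //; rewrite notin_setE => nF.
  rewrite /g (_ : q x = 0) ?powR0 ?mul0r//.
    by rewrite oppr_eq0 gt_eqF// addr_gt0.
  apply/eqP; apply: contra_notT nF => q0.
  have {}q0 : 0 < q x by rewrite lt_def q0 sqdist_ge0.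
  exists (Num.trunc (q x)^-1) => //=.
  by rewrite /F/= invf_ple ?posrE// ltW// truncnS_gt.
rewrite -/(int_mu mu g) UF; apply: (@le_lt_trans _ _ (2 `^ s * M)%:E).
  have mhF k : measurable_fun (F k) h by exact: measurable_funTS.
  have cv := @ge0_nondecreasing_set_cvg_integral _ _ _ F h (lebesgue_rV R N)
    ndF mF mhF    (fun k x _ => h0 x).
  by apply: (cvge_le _ cv); apply: nearW => k; exact: int_F.
exact: ltry.
Qed.

(** Removes the cutoff: where [q <= 1/2] its square is at least [exp(-4)], and where [q > 1/2] the
    power is bounded by its value at [1/2]. *)
Lemma loc_integrable_supercritical :
  (int_mu mu (fun x => (q x `^ (- (s + 1)) * cutoff (1 - q x) ^+ 2)%R) < +oo)%E ->
  loc_integrable_mu mu (fun x => q x `^ (- (s + 1))).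
Proof.
move=> gfin; pose g x := q x `^ (- (s + 1)) * cutoff (1 - q x) ^+ 2.
have mg : measurable_fun setT g.
  apply: measurable_funM; first exact: measurable_sqdist_powR.
  apply: measurable_funX; apply: (@measurable_radial 1) => //.
  exact: radial_flat.
have g0 x : 0 <= g x by rewrite mulr_ge0 ?powR_ge0 ?sqr_ge0.
have eg0 x : 0 <= expR 4 * g x by rewrite mulr_ge0// expR_ge0.
apply: (loc_integrable_mu_le mu_ge0 mmu (c := (1 / 2) `^ (- (s + 1)))
  (g := fun x => expR 4 * g x)) => //.
- exact: measurable_sqdist_powR.
- exact: measurable_funM.
- by move=> x; exact: powR_ge0.
- move=> x; have [q2|q2] := leP (q x) (1 / 2).
    rewrite -[leLHS]add0r lerD ?powR_ge0// mulrCA ler_peMr ?powR_ge0//.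
    by rewrite -ler_pdivrMl ?expR_gt0// mulr1 -expRN cutoff_sqr_ge.
  rewrite -[leLHS]addr0 lerD//.
  have q0 : 0 < q x by apply: lt_trans q2; rewrite divr_gt0.
  rewrite !powRN lef_pV2 ?posrE ?powR_gt0// ?divr_gt0//.
  by rewrite ge0_ler_powR ?nnegrE ?(ltW q0) ?(ltW q2) ?addr_ge0 ?(ltW s0).
move=> L cL; have mL := compact_measurable_rV cL.
apply: (@le_lt_trans _ _ (int_mu mu (fun x => expR 4 * g x))).
  apply: le_int_mu => //.
  - by apply: measurable_mul_indic => //; exact: measurable_funM.
  - exact: measurable_funM.
  - by move=> x; rewrite mulr_ge0// indicE.
  - by move=> x; rewrite ler_piMr// indicE lern1 leq_b1.
by rewrite int_muZ ?expR_ge0// lte_mul_pinfty ?lee_fin ?expR_ge0.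
Qed.

End hardy_energy.

(** * Choice of the exponent [s] and contradiction with the critical exponent *)

Theorem theorem5p1 (R : realType) (N n : nat) (hN : (3 <= N)%N)
    (hn : (2 <= n)%N) (a : 'I_n -> 'rV[R]_N) (ha : injective a)
    (mu : 'rV[R]_N -> R) (mu_ge0 : forall x, 0 <= mu x)
    (Dmu : 'rV[R]_N -> 'rV[R]_N) (H1 : hypothesis_H1 mu Dmu)
    (k1 k2 : R) (hk2 : 2 - N%:R < k2)
    (alpha : R) (halpha : alpha < 0)
    (H2 : hypothesis_H2' a mu Dmu k1 k2 alpha)
    (H3 : hypothesis_H3 a mu k2)
    (c : R) (hc : ((N%:R + k2 - 2) / 2) ^+ 2 < c)
    (k0 : R) (hk0_ge0 : 0 <= k0) (hk0_lt : k0 < pi ^+ 2) :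
  ~ (forall (phi : 'rV[R]_N -> R) (Dphi : 'rV[R]_N -> 'rV[R]_N),
      H1_mu mu phi Dphi ->
      (c%:E * int_mu mu (fun x =>
          (\sum_(i < n) phi x ^+ 2 / enorm (x - a i) ^+ 2)%R) <=
       int_mu mu (fun x => (enorm (Dphi x) ^+ 2)%R) +
       ((k0 + (n%:R + 1) * c) / pole_radius a ^+ 2 + k1)%:E *
         int_mu mu (fun x => (phi x ^+ 2)%R))%E).
Proof.
move=> hardy; have [[lmu _ _] _ _] := H1; have [i0 supE] := H3.
have N0 : (0 < N)%N by exact: ltn_trans hN.
(* Thus [m ^+ 2] is the Hardy constant, and [m + 1] is half the critical exponent [N + k2]. *)
pose m := (N%:R + k2 - 2) / 2.
have m0 : 0 < m by rewrite /m; lra.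
have [s [s0 ms sm sc]] : exists s, [/\ 0 < s, m < s, s < m + 1 & s ^+ 2 < c].
  (* Since [t < 1], [(m + t)^2 < m^2 + t (2m + 1)], and the second bound on [t] makes this at most
     the midpoint of [m^2] and [c]. *)
  pose t := Num.min (1 / 2) ((c - m ^+ 2) / (2 * (2 * m + 1))).
  have t0 : 0 < t.
    by rewrite lt_min !divr_gt0// ?subr_gt0// mulr_gt0// addr_gt0// mulr_gt0.
  have t1 : t <= 1 / 2 by rewrite ge_min lexx.
  have : t <= (c - m ^+ 2) / (2 * (2 * m + 1)) by rewrite ge_min lexx orbT.
  have n0 : 0 < 2 * (2 * m + 1) by lra.
  rewrite ler_pdivlMr// => tc; exists (m + t); split; [lra|lra|lra|].
  have : m ^+ 2 < c := hc.
  nra.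
have c0 : 0 < c by apply: le_lt_trans sc; exact: sqr_ge0.
(* As [2t] lies below the supremum, some admissible exponent exceeds it, and smaller positive
   exponents are then admissible as well. *)
have lpole t : 0 < t -> t < m + 1 ->
    loc_integrable_mu mu (fun x => sqdist (a i0) x `^ (- t)).
  move=> t0 tm; have : ((2 * t)%:E < (N%:R + k2)%:E)%E.
    by rewrite lte_fin; move: tm; rewrite /m; lra.
  rewrite -supE => /ereal_sup_gt[_ /= [t' lt' <-]]; rewrite lte_fin => tt'.
  apply: (loc_integrable_pole_le (t' := t' / 2) _ lmu) => //; first by lra.
  by move: lt'; under [X in loc_integrable_mu _ X]eq_fun do rewrite powR_enormV.
have ls := lpole s s0 sm.
(* The exponent 1 is below [m + 1] because [m > 0], that is, [k2 > 2 - N]. *)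
have l1 : loc_integrable_mu mu (fun x => sqdist (a i0) x `^ (- 1)).
  by apply: lpole => //; lra.
have [|M AM] := hardy_quot_bounded mu_ge0 lmu N0 s0 ls l1
  (k := (k0 + (n%:R + 1) * c) / pole_radius a ^+ 2 + k1) sc.
  move=> e e0; have mu_m : measurable_fun setT mu.
    by case: lmu => /measurable_EFinP.
  apply: le_trans (hardy _ _ (H1_mu_hardy_fun mu_ge0 lmu N0 s0 ls l1 e0)).
  have quotE x i : hardy_fun (a i0) e s x ^+ 2 / enorm (x - a i) ^+ 2 =
      hardy_fun (a i0) e s x ^+ 2 / sqdist (a i) x by rewrite enorm_sqr.
  have quot_ge0 x i : 0 <= hardy_fun (a i0) e s x ^+ 2 / sqdist (a i) x.
    by rewrite divr_ge0 ?sqr_ge0 ?sqdist_ge0.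
  (* Since [c > 0] and all terms are nonnegative, the sum over the poles may be reduced to its term
     at [i0]. *)
  rewrite lee_wpmul2l ?lee_fin ?(ltW c0)//.
  under [in leRHS]eq_fun do under eq_bigr do rewrite quotE.
  apply: (le_int_mu mu_ge0 mu_m) => //.
  - exact: measurable_hardy_quot.
  - by apply: measurable_sum => i; exact: measurable_hardy_quot.
  - by move=> x; rewrite (bigD1 i0)//= lerDl sumr_ge0.
have lsup := loc_integrable_supercritical mu_ge0 lmu s0
  (hardy_quot_limit mu_ge0 lmu s0 AM).
(* The exponent [2 (s + 1)] is now admissible, although [s > m] places it above the supremum. *)
have : ((2 * (s + 1))%:E <= (N%:R + k2)%:E)%E.
  rewrite -supE; apply: ereal_sup_ubound; exists (2 * (s + 1)) => //=.
  under [X in loc_integrable_mu _ X]eq_fun do rewrite powR_enormV.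
  by rewrite mulrAC divff ?mul1r.
by rewrite lee_fin; move: ms; rewrite /m; lra.
Qed.
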